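(* Let $0<q<1$ and let $\{\tilde\omega_n(z;q)\}_{n\in\mathbb N_0}$ and $\{\hat\omega_n(z;q)\}_{n\in\mathbb N_0}$ be conjugate even $q$-Lidstone sequences of type II, with numerical sequences $(\tilde\gamma_{2n})_n$ and $(\tilde\xi_{2n})_n$ respectively. Put $\tilde h_q(t)=\sum_{n=0}^\infty\tilde\gamma_{2n}\frac{t^{2n}}{[2n]_q!}$. Then, as formal power series in $t$, $$\tilde h_q(t)\,\mathrm{Cosh}_q(zt)=\sum_{n=0}^\infty\tilde\omega_n(z;q)\frac{t^{2n}}{[2n]_q!},\qquad \frac{1}{\tilde h_q(t)}\,\mathrm{Cosh}_q(zt)=\sum_{n=0}^\infty\hat\omega_n(z;q)\frac{t^{2n}}{[2n]_q!}.$$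
   Context: Fix $0<q<1$. Put $[m]_q=\frac{1-q^m}{1-q}$, $[m]_q!=\prod_{j=1}^m[j]_q$, $[0]_q!=1$, and ${n \brack k}_q=\frac{[n]_q!}{[k]_q!\,[n-k]_q!}$ for $0\le k\le n$. $\mathbb N_0=\{0,1,2,\dots\}$. Even $q$-Lidstone sequences of type II are the polynomial sequences of the form $\tilde\omega_n(z;q)=\sum_{k=0}^n{2n \brack 2k}_q q^{k(2k-1)}\,\tilde\gamma_{2(n-k)}\,z^{2k}$ $(n\in\mathbb N_0)$, where $(\tilde\gamma_{2k})_{k\ge0}$ is a sequence of real numbers with $\tilde\gamma_0\ne0$. Let $(\tilde\xi_{2n})_{n\ge0}$ be the unique real sequence with $\sum_{j=0}^n\frac{\tilde\xi_{2j}\,\tilde\gamma_{2(n-j)}}{[2j]_q!\,[2(n-j)]_q!}=\delta_{n0}$ for all $n\in\mathbb N_0$. The conjugate sequence of $\{\tilde\omega_n\}_n$ is $\hat\omega_n(z;q)=\sum_{k=0}^n{2n \brack 2k}_q q^{k(2k-1)}\,\tilde\xi_{2(n-k)}\,z^{2k}$. $\mathrm{Cosh}_q(x)=\cosh_{1/q}(x)=\sum_{n=0}^\infty q^{n(2n-1)}\frac{x^{2n}}{[2n]_q!}$. Since $\tilde\gamma_0\neq0$, $\tilde h_q(t)$ is invertible as a power series. *)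

(* Defs.v *)
From HB Require Import structures.
From mathcomp Require Import all_boot all_order all_algebra.
From mathcomp Require Import boolp reals.
Set Implicit Arguments.
Unset Strict Implicit.
Unset Printing Implicit Defensive.
Import Order.TTheory GRing.Theory Num.Theory.
Local Open Scope ring_scope.

(* Formal power series in one variable over A.  The record hides nat -> A from
   the pointwise ring structure on functions: multiplication here is the
   Cauchy product. *)
Record fps (A : Type) := FPS { coefs : nat -> A }.

Lemma fps_eq (A : Type) (f g : fps A) :
  (forall n, coefs f n = coefs g n) -> f = g.
Proof. by case: f g => [f] [g] /= fg; congr FPS; apply/funext. Qed.

HB.instance Definition _ (A : Type) := gen_eqMixin (fps A).
HB.instance Definition _ (A : Type) := gen_choiceMixin (fps A).

Section FpsZmod.
Variable A : zmodType.
Implicit Types f g h : fps A.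

Definition fps_zero : fps A := FPS (fun=> 0).
Definition fps_opp f : fps A := FPS (fun n => - coefs f n).
Definition fps_add f g : fps A := FPS (fun n => coefs f n + coefs g n).

Fact fps_addA : associative fps_add.
Proof. by move=> f g h; apply: fps_eq => n /=; rewrite addrA. Qed.
Fact fps_addC : commutative fps_add.
Proof. by move=> f g; apply: fps_eq => n /=; rewrite addrC. Qed.
Fact fps_add0 : left_id fps_zero fps_add.
Proof. by move=> f; apply: fps_eq => n /=; rewrite add0r. Qed.
Fact fps_addN : left_inverse fps_zero fps_opp fps_add.
Proof. by move=> f; apply: fps_eq => n /=; rewrite addNr. Qed.

HB.instance Definition _ :=
  GRing.isZmodule.Build (fps A) fps_addA fps_addC fps_add0 fps_addN.

End FpsZmod.

Section FpsRing.
Variable A : comNzRingType.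
Implicit Types f g h : fps A.

Definition fps_one : fps A := FPS (fun n => (n == 0%N)%:R).
Definition fps_mul f g : fps A :=
  FPS (fun n => \sum_(i < n.+1) coefs f i * coefs g (n - i)).

Definition fps_trunc N f : {poly A} := \poly_(i < N) coefs f i.

Lemma coef_fps_mul N f g n : (n < N)%N ->
  coefs (fps_mul f g) n = (fps_trunc N f * fps_trunc N g)`_n.
Proof.
move=> nN; rewrite coefM; apply: eq_bigr => i _; rewrite !coef_poly.
have iN : (i < N)%N by apply: leq_ltn_trans nN; rewrite -ltnS.
by rewrite iN (leq_ltn_trans (leq_subr _ _) nN).
Qed.

Lemma coef_trunc_mul N f g n : (n < N)%N ->
  (fps_trunc N (fps_mul f g))`_n = (fps_trunc N f * fps_trunc N g)`_n.
Proof. by move=> nN; rewrite coef_poly nN (coef_fps_mul f g nN). Qed.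

Fact fps_mulC : commutative fps_mul.
Proof.
by move=> f g; apply: fps_eq => n; rewrite !(@coef_fps_mul n.+1) // mulrC.
Qed.

Fact fps_mulA : associative fps_mul.
Proof.
move=> f g h; apply: fps_eq => n; rewrite !(@coef_fps_mul n.+1) //.
transitivity ((fps_trunc n.+1 f * (fps_trunc n.+1 g * fps_trunc n.+1 h))`_n).
  rewrite !coefM; apply: eq_bigr => i _.
  by rewrite coef_trunc_mul // ltnS leq_subr.
rewrite mulrA !coefM; apply: eq_bigr => i _.
by rewrite coef_trunc_mul.
Qed.

Fact fps_mul1 : left_id fps_one fps_mul.
Proof.
move=> f; apply: fps_eq => n /=.
rewrite big_ord_recl /= subn0 mul1r big1 ?addr0 // => i _.
by rewrite /= mul0r.
Qed.

Fact fps_mulDl : left_distributive fps_mul (@fps_add A).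
Proof.
move=> f g h; apply: fps_eq => n /=; rewrite -big_split /=.
by apply: eq_bigr => i _; rewrite mulrDl.
Qed.

Fact fps_one_neq0 : fps_one != fps_zero A.
Proof.
apply/eqP => /(congr1 (fun f => coefs f 0%N)) /= /eqP.
by rewrite oner_eq0.
Qed.

HB.instance Definition _ := GRing.Zmodule_isComNzRing.Build (fps A)
  fps_mulA fps_mulC fps_mul1 fps_mulDl fps_one_neq0.

End FpsRing.

Section FpsUnit.
Variable A : comUnitRingType.
Implicit Types f g : fps A.

Definition fps_unit : {pred fps A} := [pred f | coefs f 0%N \is a GRing.unit].

(* The first n.+1 coefficients of the inverse, from the recursion
   f_0 * g_(n+1) = - \sum_(i <= n) f_(i+1) * g_(n-i). *)
Fixpoint fps_inv_seq f n : seq A :=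
  if n is m.+1 then
    let s := fps_inv_seq f m in
    rcons s (- (coefs f 0%N)^-1 * \sum_(i < m.+1) coefs f i.+1 * s`_(m - i))
  else [:: (coefs f 0%N)^-1].

Definition fps_inv f : fps A :=
  if fps_unit f then FPS (fun n => (fps_inv_seq f n)`_n) else f.

Lemma size_fps_inv_seq f n : size (fps_inv_seq f n) = n.+1.
Proof. by elim: n => //= n IH; rewrite size_rcons IH. Qed.

Lemma nth_fps_inv_seq f n i : (i <= n)%N ->
  (fps_inv_seq f n)`_i = (fps_inv_seq f i)`_i.
Proof.
elim: n => [|n IH]; first by rewrite leqn0 => /eqP ->.
rewrite leq_eqVlt => /orP[/eqP -> //|]; rewrite ltnS => lin.
by rewrite /= nth_rcons size_fps_inv_seq ltnS lin IH.
Qed.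

Fact fps_mulVr : {in fps_unit, left_inverse 1 fps_inv *%R}.
Proof.
move=> f uf; have u0 : coefs f 0%N \is a GRing.unit by [].
rewrite mulrC; apply: fps_eq; rewrite /fps_inv [fps_unit f]uf.
case=> [|n]; rewrite /GRing.mul /= big_ord_recl /= ?subn0.
  by rewrite big_ord0 addr0 mulrV.
rewrite nth_rcons size_fps_inv_seq ltnn eqxx mulrA mulrN mulrV // mulN1r.
rewrite [X in - X](_ : _ = \sum_(i < n.+1)
    coefs f (bump 0 i) * (fps_inv_seq f (n.+1 - bump 0 i))`_(n.+1 - bump 0 i));
  first by rewrite addNr.
apply: eq_bigr => i _; rewrite /bump /= add1n subSS.
by rewrite nth_fps_inv_seq // leq_subr.
Qed.

Fact fps_unitPl f g : g * f = 1 -> fps_unit f.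
Proof.
move=> /(congr1 (fun h => coefs h 0%N)).
rewrite /GRing.mul /= big_ord_recl big_ord0 addr0 /= => gf1.
by apply/unitrPr; exists (coefs g 0); rewrite mulrC.
Qed.

Fact fps_inv_out : {in [predC fps_unit], fps_inv =1 id}.
Proof.
by move=> f; rewrite inE /= /fps_inv => /negbTE nuf; rewrite [fps_unit f]nuf.
Qed.

HB.instance Definition _ := GRing.ComNzRing_hasMulInverse.Build (fps A)
  fps_mulVr fps_unitPl fps_inv_out.

End FpsUnit.

Definition map_fps (A B : Type) (phi : A -> B) (f : fps A) : fps B :=
  FPS (fun n => phi (coefs f n)).

(* f(x) |-> f(c t) *)
Definition fps_dilate (A : pzRingType) (c : A) (f : fps A) : fps A :=
  FPS (fun n => c ^+ n * coefs f n).

(* \sum_n a_n t^(2n) *)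
Definition even_fps (A : nmodType) (a : nat -> A) : fps A :=
  FPS (fun n => if odd n then 0 else a n./2).

Section QLidstone.
Variables (R : realType) (q : R).

Definition qnum (m : nat) : R := (1 - q ^+ m) / (1 - q).
Definition qfact (m : nat) : R := \prod_(1 <= j < m.+1) qnum j.
Definition qbinom (n k : nat) : R := qfact n / (qfact k * qfact (n - k)).

(* In the natural-number exponents below, 2k - 1 is truncated at k = 0, where
   k(2k - 1) is 0 all the same. *)
Definition qCosh : fps R :=
  even_fps (fun n => q ^+ (n * (2 * n - 1)) / qfact (2 * n)).

(* Cosh_q(zt) as a power series in t over R[z]; 'X : {poly R} plays z. *)
Definition qCosh_zt : fps {poly R} :=
  fps_dilate 'X (map_fps (@polyC R) qCosh).

(* Throughout, c k stands for the sequence element of (even) index 2k, as in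
   gamma_(2k), xi_(2k). *)
Definition qlidstone_poly (c : nat -> R) (n : nat) : {poly R} :=
  \sum_(k < n.+1)
    (qbinom (2 * n) (2 * k) * q ^+ (k * (2 * k - 1)) * c (n - k)%N) *: 'X^(2 * k).

Definition even_qlidstone_II (gamma : nat -> R) (omega : nat -> {poly R}) :=
  gamma 0%N != 0 /\ forall n, omega n = qlidstone_poly gamma n.

Definition conjugate_numbers (gamma xi : nat -> R) :=
  forall n, \sum_(j < n.+1)
    xi j * gamma (n - j)%N / (qfact (2 * j) * qfact (2 * (n - j))) = (n == 0%N)%:R.

Definition conjugate_even_qlidstone_II (gamma xi : nat -> R)
    (omega omegahat : nat -> {poly R}) :=
  [/\ even_qlidstone_II gamma omega, conjugate_numbers gamma xi
    & forall n, omegahat n = qlidstone_poly xi n].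

(* \sum_n c_(2n) t^(2n) / [2n]_q! *)
Definition qlidstone_h (c : nat -> R) : fps R :=
  even_fps (fun n => c n / qfact (2 * n)).

Lemma qlidstone_h_unit (gamma : nat -> R) :
  gamma 0%N != 0 -> qlidstone_h gamma \is a GRing.unit.
Proof.
move=> g0; change (gamma 0%N / qfact (2 * 0) \is a GRing.unit).
by rewrite unitfE muln0 /qfact big_geq // divr1.
Qed.

(* \sum_n p_n(z) t^(2n) / [2n]_q! *)
Definition qlidstone_genfun (p : nat -> {poly R}) : fps {poly R} :=
  even_fps (fun n => (qfact (2 * n))^-1 *: p n).

End QLidstone.

(* Main.v *)
Require Import Defs.
From mathcomp Require Import all_boot all_order all_algebra.
From mathcomp Require Import reals.
Import Order.TTheory GRing.Theory Num.Theory.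
Local Open Scope ring_scope.

(** All series involved are even in t, and even series multiply by convolving their half-indexed
    coefficients ([even_fps_mul]). Hence the coefficient of t^(2n) in h(t) Cosh_q(zt) is the sum
    over k of q^(k(2k-1)) z^(2k) / [2k]_q! times c_(2(n-k)) / [2(n-k)]_q!, which is the n-th
    Lidstone polynomial of c divided by [2n]_q! ([qlidstone_h_mul_qCosh_zt]). This works for any
    numerical sequence c. Conjugacy says exactly that the series h of [gamma] and of [xi] have
    product 1 ([qlidstone_h_conjugate]), so the second identity is the first one for [xi]. *)

Lemma big_ord_double_even (V : nmodType) (F : nat -> V) (n : nat) :
  (forall i, odd i -> F i = 0) ->
  \sum_(i < n.*2.+1) F i = \sum_(j < n.+1) F j.*2.
Proof.
move=> F0; elim: n => [|n IH]; first by rewrite !big_ord1.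
rewrite doubleS 2!big_ord_recr /= IH F0 /= ?odd_double // addr0.
by rewrite [RHS]big_ord_recr.
Qed.

Lemma even_fps_mul (A : comNzRingType) (a b : nat -> A) :
  even_fps a * even_fps b
  = even_fps (fun n => \sum_(i < n.+1) a i * b (n - i)%N).
Proof.
apply: fps_eq => n; rewrite {1}/GRing.mul /=.
case: ifP => [on | /negbT en].
  (* For odd [n], one of [i] and [n - i] is odd, so every term vanishes. *)
  apply: big1 => i _; rewrite oddB -1?ltnS // on.
  by case: (odd i); rewrite ?mul0r ?mulr0.
rewrite -[in LHS](even_halfK en).
rewrite (big_ord_double_even A (fun i =>
  (if odd i then 0 else a i./2) *
  (if odd (n./2.*2 - i) then 0 else b (n./2.*2 - i)./2))); last first.
  by move=> i ->; rewrite mul0r.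
by apply: eq_bigr => i _; rewrite -doubleB !odd_double !doubleK.
Qed.

Lemma eq_even_fps (A : nmodType) (a b : nat -> A) :
  a =1 b -> even_fps a = even_fps b.
Proof. by move=> ab; apply: fps_eq => n /=; rewrite ab. Qed.

Lemma map_even_fps (A B : nmodType) (phi : A -> B) (a : nat -> A) :
  phi 0 = 0 -> map_fps phi (even_fps a) = even_fps (phi \o a).
Proof. by move=> phi0; apply: fps_eq => n /=; case: ifP. Qed.

Lemma dilate_even_fps (A : pzRingType) (c : A) (a : nat -> A) :
  fps_dilate c (even_fps a) = even_fps (fun n => c ^+ (2 * n) * a n).
Proof.
apply: fps_eq => n /=; case: ifP => [_ | /negbT en]; first by rewrite mulr0.
by rewrite mul2n even_halfK.
Qed.

Section QFactorial.
Variables (R : realType) (q : R).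
Hypotheses (q_gt0 : 0 < q) (q_lt1 : q < 1).

Lemma qnum_gt0 m : (0 < m)%N -> 0 < qnum q m.
Proof.
move=> m0; rewrite divr_gt0 ?subr_gt0 //.
by rewrite exprn_ilt1 ?ltW // -lt0n.
Qed.

Lemma qfact_neq0 m : qfact q m != 0.
Proof.
rewrite gt_eqF // /qfact big_nat prodr_gt0 // => j /andP[j0 _].
exact: qnum_gt0.
Qed.

Lemma qlidstone_h_mul_qCosh_zt (c : nat -> R) (p : nat -> {poly R}) :
  (forall n, p n = qlidstone_poly q c n) ->
  map_fps polyC (qlidstone_h q c) * qCosh_zt q = qlidstone_genfun q p.
Proof.
(* Commuting puts the Cosh factor first, so that the convolution index is the exponent index [k] of
   [qlidstone_poly]. *)
move=> pE; rewrite mulrC /qCosh_zt !map_even_fps // dilate_even_fps.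
rewrite even_fps_mul; apply: eq_even_fps => n /=.
rewrite pE /qlidstone_poly scaler_sumr; apply: eq_bigr => k _.
rewrite -[LHS]mulrA -polyCM mulrC mul_polyC scalerA; congr (_ *: _).
(* The factor 1/[2n]_q! cancels the numerator of the q-binomial; this uses 0 < q < 1 through
   [qfact_neq0]. *)
rewrite /qbinom -mulnBr -!mulrA mulKf ?qfact_neq0 // invfM -!mulrA.
by rewrite [LHS]mulrCA; congr (_ * _); rewrite [RHS]mulrC -mulrA.
Qed.

Lemma qlidstone_h_conjugate (gamma xi : nat -> R) :
  conjugate_numbers q gamma xi ->
  (qlidstone_h q gamma)^-1 = qlidstone_h q xi.
Proof.
move=> conj; apply: mulr1_eq; rewrite mulrC even_fps_mul.
apply: fps_eq => n /=; case: ifP => [|/negbT en]; first by case: n.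
(* The relation yields the indicator of [n./2 == 0], the series 1 that of [n == 0]; for even [n]
   they agree by doubling. *)
have := conj n./2; rewrite -[in X in _ = X -> _]double_eq0 even_halfK // => <-.
by apply: eq_bigr => j _; rewrite invfM mulrACA.
Qed.

End QFactorial.

Theorem theorem4p21 (R : realType) (q : R) (hq0 : 0 < q) (hq1 : q < 1)
    (gamma xi : nat -> R) (omega omegahat : nat -> {poly R})
    (hconj : conjugate_even_qlidstone_II q gamma xi omega omegahat) :
  map_fps polyC (qlidstone_h q gamma) * qCosh_zt q = qlidstone_genfun q omega
  /\ map_fps polyC (qlidstone_h q gamma)^-1 * qCosh_zt q
     = qlidstone_genfun q omegahat.
Proof.
case: hconj => -[_ omegaE] /qlidstone_h_conjugate -> omegahatE.
by split; apply: qlidstone_h_mul_qCosh_zt.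
Qed.
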